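(* Let $G$ be a finite simple graph with vertex set $V$ and maximum degree $\Delta(G)$. Then $$\mathcal M(G)\le \lambda_{\max}(G)\le \sqrt{\big(\log\Delta(G)+1\big)\big(\tfrac14\log|V|+1\big)}\,\mathcal M(G).$$
   Context: $\lambda_{\max}(G)$ is the largest eigenvalue of the adjacency matrix $A$ of $G$. For subsets $X,Y\subseteq V$, $e(X,Y)$ denotes the number of ordered pairs $(x,y)\in X\times Y$ with $xy$ an edge of $G$ (equivalently $\xi^tA\eta$ with $\xi,\eta$ the characteristic vectors of $X,Y$). Define $\mathcal M(G):=\max_{\emptyset\ne X,Y\subseteq V}e(X,Y)/\sqrt{|X||Y|}$. $\log$ denotes the natural logarithm. *)

(* Defs.v *)
From HB Require Import structures.
From mathcomp Require Import all_boot all_order all_algebra.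
From mathcomp Require Import boolp classical_sets reals exp.

Set Implicit Arguments.
Unset Strict Implicit.
Unset Printing Implicit Defensive.

Import Order.TTheory GRing.Theory Num.Theory.
Local Open Scope ring_scope.

(* A finite simple graph is a symmetric irreflexive [adj : rel V] on a finite
   type [V]; its adjacency matrix is indexed through [enum_val]. *)

Definition adjmx (R : realType) (V : finType) (adj : rel V) : 'M[R]_#|V| :=
  \matrix_(i, j) (adj (enum_val i) (enum_val j))%:R.

(* When [adj] is symmetric and [V] is nonempty, the set of real eigenvalues is
   finite and nonempty, so its supremum is its largest element.  If [V] is
   empty there are no eigenvalues and the value is [sup set0 = 0]. *)
Definition lambda_max (R : realType) (V : finType) (adj : rel V) : R :=
  sup [set a : R | eigenvalue (adjmx R adj) a]%classic.

Definition degree (V : finType) (adj : rel V) (x : V) : nat :=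
  #|[pred y | adj x y]|.

Definition max_degree (V : finType) (adj : rel V) : nat :=
  (\max_(x : V) degree adj x)%N.

(* Ordered pairs: an edge with both ends in [X :&: Y] is counted twice. *)
Definition edge_pairs (V : finType) (adj : rel V) (X Y : {set V}) : nat :=
  #|[pred p : V * V | [&& p.1 \in X, p.2 \in Y & adj p.1 p.2]]|.

(* The quotients are nonnegative, so the default [0] of the iterated maximum
   only matters when [V] is empty, i.e. when the range is. *)
Definition calM (R : realType) (V : finType) (adj : rel V) : R :=
  \big[Num.max/0]_(P : {set V} * {set V}
                   | (P.1 != finset.set0) && (P.2 != finset.set0))
     ((edge_pairs adj P.1 P.2)%:R / Num.sqrt (#|P.1|%:R * #|P.2|%:R)).

(* Main.v *)
(* Write [Q f] for the quadratic form of the adjacency matrix, [M] for [calM].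
   A nonnegative [f] is a combination [\sum_i d_i 1_(X_i)] of indicators of its
   superlevel sets, so that [Q f <= M (\sum_i d_i sqrt #|X_i|) ^ 2].  Listing the
   values of [f] in decreasing order [f_1, f_2, ..], summation by parts turns the
   sum into [\sum_k f_k (sqrt k - sqrt (k - 1))], and Cauchy-Schwarz with
   [(sqrt k - sqrt (k - 1)) ^ 2 <= ln (k / (k - 1)) / 4] for [1 < k] gives
   [Q f <= (ln #|V| / 4 + 1) M |f|^2].
   On the other hand [2 u v] is the integral over [r > 0] of
   [(min u (v / r)) ^ 2].  For fixed [r], decomposing [f ^ 2] and [(f / r) ^ 2]
   along common levels bounds the contribution of [r] by [(M / r) |f|^2], whence
   [2 M ln Delta |f|^2] for [r] in [1 / Delta, Delta]; the other [r] contribute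
   at most [(u ^ 2 + v ^ 2) / Delta] for each pair of adjacent vertices, hence
   [2 |f|^2 <= 2 M |f|^2] altogether.  So [Q f <= (ln Delta + 1) M |f|^2], and
   the upper bound is the geometric mean of the two estimates.
   The lower bound is Rayleigh's principle, polarized at normalized indicators. *)
Require Import Defs.
From mathcomp Require Import all_boot all_order all_algebra.
From mathcomp Require Import boolp classical_sets reals exp.
From mathcomp Require Import ring lra.

Set Implicit Arguments.
Unset Strict Implicit.
Unset Printing Implicit Defensive.

Import Order.TTheory GRing.Theory Num.Theory.
Local Open Scope ring_scope.

(** * Increments bounded by logarithms, and increments of the square root *)

Local Notation expR := sequences.expR.

(** This stands in for integrating [K / x]: cut the interval from [a] to [b] into [N + 1] steps of
    equal ratio [expR x]. Each step costs at most [K * (expR x - 1)], and [N.+1%:R * (expR x - 1)]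
    tends to [ln (b / a)]. *)
Lemma increment_le_ln (R : realType) (phi : R -> R) (K a b : R) :
  0 <= K ->
  (forall x y : R, 0 < x -> x <= y -> phi y - phi x <= K * (y - x) / x) ->
  0 < a -> a <= b -> phi b - phi a <= K * ln (b / a).
Proof.
move=> K0 Hphi a0 ab.
have b0 : 0 < b by apply: lt_le_trans ab.
set L := ln (b / a); set D := phi b - phi a.
have L0 : 0 <= L by apply: ln_ge0; rewrite ler_pdivlMr // mul1r.
have [D0|D0] := leP D 0; first by apply: le_trans D0 _; apply: mulr_ge0.
(* The factor [1 - x], with [x = L / N.+1%:R], pays for replacing [expR x - 1] by [x], since
   [(expR x - 1) * (1 - x) <= x]. *)
have step N : D * (1 - L / N.+1%:R) <= K * L.
  have N0 : 0 < N.+1%:R :> R by rewrite ltr0n.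
  set x := L / N.+1%:R.
  have x0 : 0 <= x by apply: divr_ge0 => //; apply: ltW.
  have q1 : 1 <= expR x by rewrite -expR0 ler_expR.
  have ind j :
      phi (a * expR x ^+ j) - phi a <= K * (j%:R * (expR x - 1)).
    elim: j => [|j IH]; first by rewrite expr0 mulr1 subrr mul0r mulr0.
    have p0 : 0 < a * expR x ^+ j.
      by rewrite mulr_gt0 // exprn_gt0 // expR_gt0.
    have pq : a * expR x ^+ j <= expR x * (a * expR x ^+ j).
      by rewrite ler_peMl // ltW.
    rewrite exprS mulrCA; have := Hphi _ _ p0 pq.
    have -> : K * (expR x * (a * expR x ^+ j) - a * expR x ^+ j)
              / (a * expR x ^+ j) = K * (expR x - 1).
      by field; have := lt0r_neq0 p0; rewrite mulf_eq0 negb_or andbC.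
    rewrite -natr1; lra.
  have xL : N.+1%:R * x = L by rewrite mulrC divfK // gt_eqF.
  have aqb : a * expR x ^+ N.+1 = b.
    rewrite -expRM_natl xL lnK ?posrE ?divr_gt0 //.
    by rewrite mulrC divfK // gt_eqF.
  have := ind N.+1; rewrite aqb -/D => HD.
  have e1 : expR x * (1 - x) <= 1.
    have := expR_ge1Dx (- x); rewrite expRN => h.
    have := expR_gt0 x => e0.
    by rewrite mulrC -ler_pdivlMr // mul1r.
  have [x1|x1] := leP 1 x.
    by apply: (@le_trans _ _ 0); [apply: mulr_ge0_le0; lra | apply: mulr_ge0].
  apply: (@le_trans _ _ (K * (N.+1%:R * (expR x - 1)) * (1 - x))).
    by rewrite ler_wpM2r //; lra.
  rewrite -!mulrA ler_wpM2l // -xL.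
  by rewrite ler_wpM2l ?(ltW N0) //; lra.
clearbody L D; rewrite leNgt; apply/negP => lt.
have e0 : 0 < D - K * L by lra.
have [N HN] : exists N : nat, D * L / (D - K * L) < N%:R.
  exists (Num.bound (D * L / (D - K * L))).
  by apply: archi_boundP; rewrite divr_ge0 // ?mulr_ge0 // ltW.
have := step N; rewrite leNgt => /negP; apply.
have N0 : 0 < N.+1%:R :> R by rewrite ltr0n.
have : D * L / N.+1%:R < D - K * L.
  rewrite ltr_pdivrMr // [ltRHS]mulrC -ltr_pdivrMr //.
  by apply: lt_trans HN _; rewrite ltr_nat.
have -> : D * (1 - L / N.+1%:R) = D - D * L / N.+1%:R.
  by rewrite mulrBr mulr1 mulrA.
by rewrite !ltrBrDr addrC.
Qed.

(** The left side vanishes at [1] and has derivative [4 / (r + 1) ^ 2], at most [1 / r] because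
    [(r - 1) ^ 2 >= 0]. *)
Lemma ln_ge_pade (R : realType) (r : R) :
  1 <= r -> 2 * (r - 1) / (r + 1) <= ln r.
Proof.
move=> r1.
have := @increment_le_ln R (fun r => 2 * (r - 1) / (r + 1)) 1 1 r ler01.
rewrite subrr mulr0 mul0r subr0 divr1 mul1r; apply => // x y x0 xy.
have x1 : 0 < x + 1 by lra.
have y1 : 0 < y + 1 by lra.
have -> : 2 * (y - 1) / (y + 1) - 2 * (x - 1) / (x + 1)
          = (y - x) * (4 / ((x + 1) * (y + 1))).
  by field; rewrite !gt_eqF.
rewrite mul1r ler_wpM2l ?subr_ge0 // ler_pdivrMr ?mulr_gt0 //.
rewrite [leRHS]mulrC ler_pdivlMr //.
have yx : 0 <= y - x by rewrite subr_ge0.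
have := sqr_ge0 (x - 1); have := mulr_ge0 (ltW x1) yx.
nra.
Qed.

(** Put [a = sqrt k] and [b = sqrt (k + 1)]. As [b ^ 2 - a ^ 2 = 1], the inverse of [b + a] is
    [b - a], so the Padé bound at [b / a] reads [2 (b - a) ^ 2 <= ln (b / a)]. *)
Lemma sqr_sqrt_step (R : realType) (k : nat) :
  (0 < k)%N ->
  (Num.sqrt k.+1%:R - Num.sqrt k%:R) ^+ 2 <= 4^-1 * (ln k.+1%:R - ln k%:R) :> R.
Proof.
move=> k0.
set a := Num.sqrt k%:R; set b := Num.sqrt k.+1%:R.
have a0 : 0 < a :> R by rewrite sqrtr_gt0 ltr0n.
have b0 : 0 < b :> R by rewrite sqrtr_gt0 ltr0n.
have a2 : k%:R = a ^+ 2 :> R by rewrite sqr_sqrtr.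
have b2 : k.+1%:R = b ^+ 2 :> R by rewrite sqr_sqrtr.
have ab : a <= b by rewrite ler_wsqrtr // ler_nat.
have d1 : b ^+ 2 - a ^+ 2 = 1 by rewrite -a2 -b2 -natr1; ring.
rewrite a2 b2 !lnXn // -mulrnBl -ln_div ?posrE //.
have := @ln_ge_pade R (b / a).
rewrite ler_pdivlMr // mul1r => /(_ ab).
have ba0 : b + a != 0 by rewrite gt_eqF // addr_gt0.
have iE : (b + a)^-1 = b - a.
  by apply: (mulfI ba0); rewrite mulfV // -d1; ring.
have -> : 2 * (b / a - 1) / (b / a + 1) = 2 * (b - a) * (b + a)^-1.
  by field; rewrite ba0 gt_eqF.
rewrite iE => h; lra.
Qed.

Lemma sum_sqr_sqrt_step (R : realType) (n : nat) :
  \sum_(i < n) (Num.sqrt i.+1%:R - Num.sqrt i%:R) ^+ 2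
    <= 4^-1 * ln n%:R + 1 :> R.
Proof.
(* The convention [ln 0 = 0] covers the empty sum. Otherwise the first term is the [1], and the
   remaining bounds telescope. *)
case: n => [|n]; first by rewrite big_ord0 ln0 //; lra.
elim: n => [|n IH].
  by rewrite big_ord_recr big_ord0 /= sqrtr1 sqrtr0 ln1; lra.
rewrite big_ord_recr /=.
have := @sqr_sqrt_step R n.+1 isT; lra.
Qed.

(** * Layer decomposition and the estimate in the number of vertices *)

Lemma sqr_sum_mul_le (R : realFieldType) (I : finType) (x y : I -> R) (C : R) :
  0 < C -> \sum_i y i ^+ 2 <= C ->
  (\sum_i x i * y i) ^+ 2 <= C * \sum_i x i ^+ 2.
Proof.
move=> C0 yC; set P := \sum_i x i * y i.
have : 0 <= \sum_i (C * x i - P * y i) ^+ 2.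
  by apply: sumr_ge0 => i _; apply: sqr_ge0.
have -> : \sum_i (C * x i - P * y i) ^+ 2 =
   C ^+ 2 * (\sum_i x i ^+ 2) - 2 * C * P * P + P ^+ 2 * \sum_i y i ^+ 2.
  transitivity (\sum_i (C ^+ 2 * x i ^+ 2 - 2 * C * P * (x i * y i)
                        + P ^+ 2 * y i ^+ 2)).
    by apply: eq_bigr => i _; ring.
  by rewrite big_split sumrB /= -!mulr_sumr.
have : P ^+ 2 * \sum_i y i ^+ 2 <= P ^+ 2 * C by rewrite ler_wpM2l ?sqr_ge0.
set X := \sum_i _ ^+ 2; set Y := \sum_i _ ^+ 2 => h1 h2.
rewrite -(ler_pM2l C0); nra.
Qed.

(** [X i] holds the first [i + 1] points in decreasing order of [f], with weight the drop to the
    next value; ties get weight [0]. Stating the decomposition for minima keeps two points on common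
    levels, and [x = y] recovers [f]. *)
Lemma layer_cake (R : realType) (T : finType) (f : T -> R) :
  (forall x, 0 <= f x) ->
  exists (d : 'I_#|T| -> R) (X : 'I_#|T| -> {set T}),
  [/\ forall i, 0 <= d i,
      forall x y,
        Num.min (f x) (f y) = \sum_i d i * ((x \in X i) && (y \in X i))%:R
    & (\sum_i d i * Num.sqrt #|X i|%:R) ^+ 2
        <= (4^-1 * ln #|T|%:R + 1) * \sum_x f x ^+ 2].
Proof.
move=> f0.
pose ler := fun x y => f y <= f x.
pose s := sort ler (enum T).
have ss : size s = #|T| by rewrite size_sort cardE.
have mems x : x \in s by rewrite mem_sort mem_enum.
have ler_tr : transitive ler by move=> y x z xy yz; apply: le_trans yz xy.
have srt : sorted ler s by apply: sort_sorted => x y; apply: le_total.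
(* The default [0] past the end makes the telescoping sums stop at [0]. *)
pose a i := nth 0 (map f s) i.
have aE x : a (index x s) = f x.
  by rewrite /a (nth_map x) ?index_mem // nth_index.
have an : a #|T| = 0 by rewrite /a nth_default // size_map ss.
have am i j : (i <= j)%N -> a j <= a i.
  move=> ij; have [lt|ge] := ltnP j #|T|; last first.
    rewrite {1}/a nth_default ?size_map ?ss //.
    have [lt'|ge'] := ltnP i #|T|; last by rewrite /a nth_default ?size_map ?ss.
    have x0 : T by move: lt'; rewrite -ss; case: (s) => // x.
    by rewrite /a (nth_map x0) ?ss.
  have x0 : T by move: lt; rewrite -ss; case: (s) => // x.
  rewrite /a !(nth_map x0) ?ss //; last exact: leq_ltn_trans ij lt.
  apply: (sorted_leq_nth ler_tr _ _ srt) => //; rewrite ?inE ?ss //.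
    by move=> x; apply: lexx.
  exact: leq_ltn_trans ij lt.
pose X (i : 'I_#|T|) := [set x | (index x s <= i)%N].
exists (fun i => a i - a i.+1), X; split=> [i|x y|].
- by rewrite subr_ge0 am.
- set k := maxn (index x s) (index y s).
  have kT : (k < #|T|)%N by rewrite gtn_max -ss !index_mem !mems.
  have -> : Num.min (f x) (f y) = a k.
    rewrite -!aE /k; case: leqP => h; [rewrite min_r // | rewrite min_l //].
      exact: am.
    exact/am/ltnW.
  transitivity (\sum_(k <= i < #|T|) (a i - a i.+1)).
    rewrite (@telescope_sumr_eq _ _ _ (fun i => - a i)) ?(ltnW kT) //.
      by rewrite an oppr0 add0r opprK.
    by move=> i _; rewrite opprK addrC.
  rewrite big_geq_mkord big_mkcond /=; apply: eq_bigr => i _.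
  by rewrite !inE /k geq_max; case: ifP => _; rewrite ?mulr1 ?mulr0.
- have sumE : \sum_x f x ^+ 2 = \sum_(i < #|T|) a i ^+ 2.
    rewrite -(big_mkord xpredT (fun i => a i ^+ 2)) /a -ss -(size_map f).
    rewrite -(big_nth 0 xpredT (fun t => t ^+ 2)) big_map -[LHS]big_enum.
    by apply: perm_big; rewrite perm_sym perm_sort.
  (* Summation by parts moves the differences from the values of [f] to the square roots; the
     boundary term vanishes at [m = #|T|]. *)
  have abel m : \sum_(i < m) (a i - a i.+1) * Num.sqrt i.+1%:R =
      \sum_(i < m) a i * (Num.sqrt i.+1%:R - Num.sqrt i%:R) - a m * Num.sqrt m%:R.
    elim: m => [|m IH]; first by rewrite !big_ord0 sqrtr0; ring.
    by rewrite !big_ord_recr /= IH; ring.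
  have cardX i : (#|X i| <= i.+1)%N.
    have -> : X i = [set x in take i.+1 s].
      by apply/setP => x; rewrite !inE in_take // ltnS.
    rewrite cardsE (leq_trans (card_size _)) // size_take.
    by case: ltnP.
  have := abel #|T|; rewrite an mul0r subr0 => abelT.
  have le1 : \sum_(i < #|T|) (a i - a i.+1) * Num.sqrt #|X i|%:R <=
      \sum_(i < #|T|) a i * (Num.sqrt i.+1%:R - Num.sqrt i%:R).
    rewrite -abelT; apply: ler_sum => i _.
    by rewrite ler_wpM2l ?subr_ge0 ?am // ler_wsqrtr // ler_nat.
  have ge0 : 0 <= \sum_(i < #|T|) (a i - a i.+1) * Num.sqrt #|X i|%:R.
    by apply: sumr_ge0 => i _; rewrite mulr_ge0 ?sqrtr_ge0 // subr_ge0 am.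
  apply: le_trans
    (_ : (\sum_(i < #|T|) a i * (Num.sqrt i.+1%:R - Num.sqrt i%:R)) ^+ 2 <= _).
    by rewrite ler_sqr ?nnegrE // (le_trans ge0).
  rewrite sumE; apply: sqr_sum_mul_le; last exact: sum_sqr_sqrt_step.
  have [->|T0] := posnP #|T|; first by rewrite ln0 //; lra.
  have : 0 <= ln (#|T|%:R : R) by rewrite ln_ge0 // ler1n.
  lra.
Qed.

Lemma sum_le_ln_card (R : realType) (T : finType) (w : T -> T -> R) (M : R)
    (f : T -> R) :
  0 <= M -> (forall x, 0 <= f x) ->
  (forall X Y : {set T}, \sum_(x in X) \sum_(y in Y) w x y
     <= M * (Num.sqrt #|X|%:R * Num.sqrt #|Y|%:R)) ->
  \sum_x \sum_y w x y * (f x * f y)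
    <= (4^-1 * ln #|T|%:R + 1) * M * \sum_x f x ^+ 2.
Proof.
move=> M0 f0 wM; have [d [X [d0 minE dX]]] := layer_cake f0.
have fE x : f x = \sum_i d i * (x \in X i)%:R.
  by rewrite -[LHS]minxx minE; under eq_bigr do rewrite andbb.
apply: (@le_trans _ _ (M * (\sum_i d i * Num.sqrt #|X i|%:R) ^+ 2)); last first.
  by rewrite (mulrC _ M) -mulrA ler_wpM2l.
have -> : \sum_x \sum_y w x y * (f x * f y) =
   \sum_i \sum_j d i * d j * \sum_(x in X i) \sum_(y in X j) w x y.
  transitivity (\sum_x \sum_y \sum_i \sum_j
      d i * d j * ((x \in X i)%:R * ((y \in X j)%:R * w x y))).
    apply: eq_bigr => x _; apply: eq_bigr => y _.
    rewrite !fE big_distrlr mulr_sumr; apply: eq_bigr => i _ /=.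
    by rewrite mulr_sumr; apply: eq_bigr => j _; ring.
  under eq_bigr do rewrite exchange_big.
  rewrite exchange_big; apply: eq_bigr => i _ /=.
  under eq_bigr do rewrite exchange_big.
  rewrite exchange_big; apply: eq_bigr => j _ /=.
  rewrite mulr_sumr big_mkcond [RHS]big_mkcond; apply: eq_bigr => x _ /=.
  case: (x \in X i); last by rewrite big1 // => y _; rewrite mul0r mulr0.
  rewrite mulr_sumr [RHS]big_mkcond; apply: eq_bigr => y _ /=.
  by case: (y \in X j); rewrite !(mul1r, mul0r, mulr0).
rewrite expr2 mulr_suml mulr_sumr ler_sum // => i _.
rewrite mulr_sumr mulr_sumr ler_sum // => j _.
by rewrite [in leRHS]mulrACA [leRHS]mulrCA ler_wpM2l // mulr_ge0.
Qed.

(** * Truncated products and the estimate in the degree *)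

Lemma sum_min_le (R : realType) (T : finType) (w : T -> T -> R) (p q : R)
    (g h : T -> R) :
  (forall x, 0 <= g x) -> (forall x, 0 <= h x) ->
  (forall X Y : {set T}, \sum_(x in X) \sum_(y in Y) w x y
     <= p * #|X|%:R + q * #|Y|%:R) ->
  \sum_x \sum_y w x y * Num.min (g x) (h y) <= p * (\sum_x g x) + q * \sum_x h x.
Proof.
(* Taking the layers of [g] and [h] together on [T + T] gives common levels. *)
move=> g0 h0 wpq.
pose k (z : T + T) := match z with inl x => g x | inr y => h y end.
have k0 z : 0 <= k z by case: z.
have [d [Z [d0 minE _]]] := layer_cake k0.
pose X i := [set x | inl x \in Z i]; pose Y i := [set y | inr y \in Z i].
have gE x : g x = \sum_i d i * (x \in X i)%:R.
  have := minE (inl x) (inl x); rewrite minxx /= => ->.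
  by apply: eq_bigr => i _; rewrite andbb inE.
have hE x : h x = \sum_i d i * (x \in Y i)%:R.
  have := minE (inr x) (inr x); rewrite minxx /= => ->.
  by apply: eq_bigr => i _; rewrite andbb inE.
have sumE (A : {set T}) : \sum_x (x \in A)%:R = #|A|%:R :> R.
  by rewrite -sum1_card natr_sum [RHS]big_mkcond; apply: eq_bigr => x _; case: ifP.
(* Common levels leave a single sum, over rectangles [X i] by [Y i], so a bound linear in the two
   cardinalities adds up to the two sums. *)
have -> : \sum_x \sum_y w x y * Num.min (g x) (h y) =
    \sum_i d i * \sum_(x in X i) \sum_(y in Y i) w x y.
  transitivity (\sum_x \sum_y \sum_i
      d i * ((x \in X i)%:R * ((y \in Y i)%:R * w x y))).
    apply: eq_bigr => x _; apply: eq_bigr => y _.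
    have := minE (inl x) (inr y); rewrite /= => ->.
    rewrite mulr_sumr; apply: eq_bigr => i _.
    by rewrite !inE -mulnb natrM; ring.
  under eq_bigr do rewrite exchange_big.
  rewrite exchange_big; apply: eq_bigr => i _ /=.
  rewrite mulr_sumr [RHS]big_mkcond; apply: eq_bigr => x _ /=.
  case: (x \in X i); last by rewrite big1 // => y _; rewrite mul0r mulr0.
  rewrite mulr_sumr [RHS]big_mkcond; apply: eq_bigr => y _ /=.
  by case: (y \in Y i); rewrite !(mul1r, mul0r, mulr0).
under [\sum_x g x]eq_bigr do rewrite gE.
under [\sum_x h x]eq_bigr do rewrite hE.
rewrite exchange_big [\sum_x \sum_i d i * (x \in Y i)%:R]exchange_big /=.
rewrite !mulr_sumr -big_split ler_sum // => i _ /=.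
rewrite -!mulr_sumr !sumE (mulrCA p) (mulrCA q) -mulrDr.
by rewrite ler_wpM2l.
Qed.

(* An antiderivative of [r |-> (min u (v / r)) ^ 2] on [r > 0]. *)
Definition sqr_min_prim (R : realFieldType) (u v r : R) : R :=
  if r * u <= v then u ^+ 2 * r else 2 * u * v - v ^+ 2 / r.

(** The integrand decreases in [r], so its integral is at most the length times the value at the
    left end [a]. The cases locate the break point [v / u]. *)
Lemma sqr_min_prim_increment (R : realFieldType) (u v a b : R) :
  0 <= u -> 0 <= v -> 0 < a -> a <= b ->
  sqr_min_prim u v b - sqr_min_prim u v a
    <= (b - a) * Num.min (u ^+ 2) (v ^+ 2 / a ^+ 2).
Proof.
move=> u0 v0 a0 ab; have b0 : 0 < b by apply: lt_le_trans ab.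
have ba : 0 <= b - a by rewrite subr_ge0.
have au : a * u <= b * u by rewrite ler_wpM2r.
rewrite -expr_div_n /sqr_min_prim.
have va0 : 0 <= v / a by rewrite divr_ge0 // ltW.
case: (leP (a * u) v) => auv.
  have -> : Num.min (u ^+ 2) ((v / a) ^+ 2) = u ^+ 2.
    by apply/min_idPl; rewrite ler_sqr ?nnegrE // ler_pdivlMr // mulrC.
  case: (leP (b * u) v) => buv; first by lra.
  have -> : 2 * u * v - v ^+ 2 / b - u ^+ 2 * a
    = (b - a) * u ^+ 2 - (b * u - v) ^+ 2 / b by field; rewrite gt_eqF.
  by rewrite gerBl divr_ge0 ?sqr_ge0 // ltW.
have -> : Num.min (u ^+ 2) ((v / a) ^+ 2) = (v / a) ^+ 2.
  apply/min_idPr; rewrite ler_sqr ?nnegrE // ler_pdivrMr // mulrC.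
  exact: ltW.
rewrite [b * u <= v]leNgt (lt_le_trans auv au) /=.
have -> : 2 * u * v - v ^+ 2 / b - (2 * u * v - v ^+ 2 / a)
  = (b - a) * ((v / a) ^+ 2 * (a / b)) by field; rewrite !gt_eqF.
by rewrite ler_wpM2l // ler_piMr ?sqr_ge0 // ler_pdivrMr // mul1r.
Qed.

(** The integral over all [r > 0] is [2 u v]; the part below [1 / c] is at most [u ^ 2 / c], the
    part above [c] at most [v ^ 2 / c]. *)
Lemma sqr_min_prim_total (R : realFieldType) (u v c : R) :
  0 <= u -> 0 <= v -> 1 <= c ->
  2 * (u * v) - (u ^+ 2 + v ^+ 2) / c
    <= sqr_min_prim u v c - sqr_min_prim u v c^-1.
Proof.
move=> u0 v0 c1; have c0 : 0 < c by lra.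
have cV : c^-1 <= c by apply: (@le_trans _ _ 1) => //; rewrite invf_le1.
have cu : c^-1 * u <= c * u by rewrite ler_wpM2r.
rewrite /sqr_min_prim; case: (leP (c * u) v) => cuv.
  rewrite (le_trans cu cuv) -subr_ge0.
  have -> : u ^+ 2 * c - u ^+ 2 / c - (2 * (u * v) - (u ^+ 2 + v ^+ 2) / c)
    = (c * u - v) ^+ 2 / c by field; rewrite gt_eqF.
  by rewrite divr_ge0 ?sqr_ge0 // ltW.
case: (leP (c^-1 * u) v) => cuv'.
  by rewrite le_eqVlt; apply/orP; left; apply/eqP; field; rewrite gt_eqF.
rewrite -subr_ge0.
have -> : 2 * u * v - v ^+ 2 / c - (2 * u * v - v ^+ 2 / c^-1)
    - (2 * (u * v) - (u ^+ 2 + v ^+ 2) / c)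
  = (c * v - u) ^+ 2 / c by field; rewrite gt_eqF.
by rewrite divr_ge0 ?sqr_ge0 // ltW.
Qed.

Lemma sum_le_ln_degree (R : realType) (T : finType) (w : T -> T -> R)
    (M D c : R) (f : T -> R) :
  0 <= M -> (forall x, 0 <= f x) -> (forall x y, 0 <= w x y) ->
  (forall X Y : {set T}, \sum_(x in X) \sum_(y in Y) w x y
     <= M * (Num.sqrt #|X|%:R * Num.sqrt #|Y|%:R)) ->
  (forall x, \sum_y w x y <= D) -> (forall y, \sum_x w x y <= D) -> 1 <= c ->
  \sum_x \sum_y w x y * (f x * f y) <= (M * ln c + D / c) * \sum_x f x ^+ 2.
Proof.
move=> M0 f0 w0 wM rowD colD c1; have c0 : 0 < c by lra.
set S := \sum_x f x ^+ 2; set Q := \sum_x \sum_y _.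
have S0 : 0 <= S by apply: sumr_ge0 => x _; apply: sqr_ge0.
pose phi r := \sum_x \sum_y w x y * sqr_min_prim (f x) (f y) r.
have phiB r s : phi r - phi s = \sum_x \sum_y
    w x y * (sqr_min_prim (f x) (f y) r - sqr_min_prim (f x) (f y) s).
  rewrite -sumrB; apply: eq_bigr => x _; rewrite -sumrB.
  by apply: eq_bigr => y _; rewrite mulrBr.
have phi_inc r s : 0 < r -> r <= s -> phi s - phi r <= M * S * (s - r) / r.
  move=> r0 rs; rewrite phiB.
  apply: (@le_trans _ _ ((s - r) * \sum_x \sum_y
      w x y * Num.min (f x ^+ 2) (f y ^+ 2 / r ^+ 2))).
    rewrite mulr_sumr ler_sum // => x _; rewrite mulr_sumr ler_sum // => y _.
    by rewrite mulrCA ler_wpM2l // sqr_min_prim_increment.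
  rewrite [leRHS]mulrAC [leRHS]mulrC ler_wpM2l ?subr_ge0 //.
  (* The coefficients come from the weighted inequality of arithmetic and geometric means, balanced
     so that both sums contribute [M * S / (2 * r)]. *)
  have := @sum_min_le R T w (M / r / 2) (M * r / 2) (fun x => f x ^+ 2)
    (fun y => f y ^+ 2 / r ^+ 2).
  rewrite -mulr_suml -/S.
  have -> : M / r / 2 * S + M * r / 2 * (S / r ^+ 2) = M * S / r.
    by field; rewrite gt_eqF.
  apply=> [x|x|X Y]; rewrite ?divr_ge0 ?sqr_ge0 //.
  apply: le_trans (wM X Y) _.
  rewrite -{2}[#|X|%:R]sqr_sqrtr // -{2}[#|Y|%:R]sqr_sqrtr //.
  set a := Num.sqrt _; set b := Num.sqrt _.
  rewrite -subr_ge0.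
  have -> : M / r / 2 * a ^+ 2 + M * r / 2 * b ^+ 2 - M * (a * b)
    = M * ((a - r * b) ^+ 2 / (2 * r)) by field; rewrite gt_eqF.
  by rewrite mulr_ge0 // divr_ge0 ?sqr_ge0 // mulr_ge0 // ltW.
have cV : c^-1 <= c by apply: (@le_trans _ _ 1) => //; rewrite invf_le1.
(* The interval from [1 / c] to [c] has logarithmic length [2 * ln c]; this [2] cancels against the
   one in [2 * Q]. *)
have := increment_le_ln (mulr_ge0 M0 S0) phi_inc _ cV.
rewrite invr_gt0 => /(_ c0); rewrite ln_div ?posrE ?invr_gt0 // lnV ?posrE //.
rewrite phiB => up.
have lo : 2 * Q - (\sum_x \sum_y w x y * (f x ^+ 2 + f y ^+ 2)) / c
    <= \sum_x \sum_y w x y *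
      (sqr_min_prim (f x) (f y) c - sqr_min_prim (f x) (f y) c^-1).
  rewrite /Q mulr_sumr mulr_suml -sumrB ler_sum // => x _.
  rewrite mulr_sumr mulr_suml -sumrB ler_sum // => y _.
  by rewrite -mulrA mulrCA -mulrBr ler_wpM2l // sqr_min_prim_total.
have deg : (\sum_x \sum_y w x y * (f x ^+ 2 + f y ^+ 2)) / c <= 2 * (D / c * S).
  have -> : 2 * (D / c * S) = (2 * (D * S)) / c by ring.
  rewrite ler_wpM2r ?invr_ge0 ?(ltW c0) //.
  have -> : \sum_x \sum_y w x y * (f x ^+ 2 + f y ^+ 2) =
    \sum_x (\sum_y w x y) * f x ^+ 2 + \sum_y (\sum_x w x y) * f y ^+ 2.
    under [X in _ = _ + X]eq_bigr do rewrite mulr_suml.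
    rewrite [X in _ = _ + X]exchange_big -big_split; apply: eq_bigr => x _ /=.
    rewrite mulr_suml -big_split; apply: eq_bigr => y _ /=.
    by rewrite mulrDr.
  have -> : 2 * (D * S) = D * S + D * S by ring.
  by rewrite lerD // /S mulr_sumr ler_sum // => x _; rewrite ler_wpM2r ?sqr_ge0.
rewrite mulrDl; lra.
Qed.

(** * Quadratic forms and Rayleigh's principle *)

(** Row vectors match the left eigenvectors of [eigenvalue]. The squared norm is written
    [qform 1%:M u], so that [qform_scale] applies to it too. *)
Definition qform (R : realFieldType) (n : nat) (A : 'M[R]_n) (u : 'rV[R]_n) : R :=
  (u *m A *m u^T) 0 0.

Lemma qformE (R : realFieldType) (n : nat) (A : 'M[R]_n) (u : 'rV[R]_n) :
  qform A u = \sum_i \sum_j A i j * (u 0 i * u 0 j).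
Proof.
rewrite /qform mxE exchange_big /=; apply: eq_bigr => j _.
rewrite !mxE mulr_suml; apply: eq_bigr => i _; ring.
Qed.

Lemma qform1 (R : realFieldType) (n : nat) (u : 'rV[R]_n) :
  qform 1%:M u = \sum_i u 0 i ^+ 2.
Proof.
by rewrite /qform mulmx1 mxE; apply: eq_bigr => i _; rewrite mxE expr2.
Qed.

Lemma qform1_ge0 (R : realFieldType) (n : nat) (u : 'rV[R]_n) : 0 <= qform 1%:M u.
Proof. by rewrite qform1 sumr_ge0 // => i _; apply: sqr_ge0. Qed.

Lemma qform1_eq0 (R : realFieldType) (n : nat) (u : 'rV[R]_n) :
  (qform 1%:M u == 0) = (u == 0).
Proof.
rewrite qform1 psumr_eq0 => [|i _]; last exact: sqr_ge0.
apply/allP/eqP => [h|-> i _]; last by rewrite mxE expr0n eqxx.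
apply/rowP => i; rewrite mxE; apply/eqP; rewrite -sqrf_eq0.
exact: (h i (mem_index_enum i)).
Qed.

(** Crude, from [|u_i u_j| <= |u| ^ 2]. The added [1] makes [C] invertible; the bound is used for
    [A] and for the inverse of [mu - A]. *)
Lemma qform_le (R : realFieldType) (n : nat) (A : 'M[R]_n) :
  exists2 C, 0 < C & forall u, qform A u <= C * qform 1%:M u.
Proof.
exists (1 + \sum_i \sum_j `|A i j|) => [|u].
  by rewrite ltr_pwDl // sumr_ge0 // => i _; rewrite sumr_ge0.
rewrite mulrDl mul1r ler_wpDl ?qform1_ge0 // qformE mulr_suml.
rewrite ler_sum // => i _; rewrite mulr_suml ler_sum // => j _.
apply: le_trans (ler_norm _) _; rewrite normrM ler_wpM2l //.
have sq k : u 0 k ^+ 2 <= qform 1%:M u.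
  rewrite qform1 (bigD1 k) //= lerDl sumr_ge0 // => l _; exact: sqr_ge0.
have := sqr_ge0 (u 0 i - u 0 j); have := sqr_ge0 (u 0 i + u 0 j).
have := sq i; have := sq j; rewrite ler_norml => *; apply/andP; split; nra.
Qed.

Lemma qform_scale (R : realFieldType) (n : nat) (A : 'M[R]_n) (a : R) u :
  qform A (a *: u) = a ^+ 2 * qform A u.
Proof.
rewrite /qform linearZ /= -!scalemxAl -scalemxAr !mxE; ring.
Qed.

Lemma qform_shift (R : realFieldType) (n : nat) (A : 'M[R]_n) (a : R) u :
  qform (a%:M - A) u = a * qform 1%:M u - qform A u.
Proof.
by rewrite /qform mulmxBr mulmxBl mul_mx_scalar -scalemxAl mulmx1 !mxE.
Qed.

(* If [B = mu - A] were invertible at the supremum [mu] of the Rayleigh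
   quotients, expanding [0 <= qform B (u - t *: (u *m invmx B))] at a small
   fixed [t] would bound [qform B] away from 0 on the unit sphere. *)
Lemma rayleigh_sup_eigenvalue (R : realType) (n : nat) (A : 'M[R]_n) :
  (0 < n)%N -> A^T = A ->
  exists2 mu, eigenvalue A mu & forall u, qform A u <= mu * qform 1%:M u.
Proof.
move=> n0 AT.
pose S := [set qform A u | u in [set u | qform 1%:M u = 1]]%classic.
have [C0 C00 C0P] := qform_le A.
have ubS : ubound S C0.
  by move=> _ [u /= u1 <-]; rewrite -[C0]mulr1 -u1.
have S0 : (S !=set0)%classic.
  pose e : 'rV[R]_n := delta_mx 0 (Ordinal n0).
  exists (qform A e), e => //=.
  rewrite qform1 (bigD1 (Ordinal n0)) //= big1 => [|i ne].
    by rewrite mxE !eqxx expr1n addr0.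
  by rewrite mxE (negbTE ne) andbF expr0n.
have hS : has_sup S by split => //; exists C0.
pose mu := sup S.
have muP u : qform A u <= mu * qform 1%:M u.
  have [->|u0] := eqVneq u 0.
    by rewrite /qform !mul0mx mxE mulr0.
  have N0 : 0 < qform 1%:M u by rewrite lt0r qform1_eq0 u0 qform1_ge0.
  pose a := (Num.sqrt (qform 1%:M u))^-1.
  have a2 : a ^+ 2 = (qform 1%:M u)^-1 by rewrite exprVn sqr_sqrtr // ltW.
  have : qform A (a *: u) <= mu.
    apply: sup_upper_bound => //; exists (a *: u) => //=.
    by rewrite qform_scale a2 mulVf // gt_eqF.
  by rewrite qform_scale a2 mulrC ler_pdivrMr.
exists mu => //.
apply: contrapT => /negP; rewrite negbK => /eqP.
set B := A - mu%:M => /eqP; rewrite kermx_eq0 row_free_unit => unitB.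
pose B' := mu%:M - A.
have B'E : B' = - B by rewrite /B' /B opprB.
have unitB' : B' \in unitmx by rewrite B'E -scaleN1r unitmxZ // unitrN1.
have B'T : B'^T = B' by rewrite /B' linearB /= tr_scalar_mx AT.
have B'q u : qform B' u = mu * qform 1%:M u - qform A u by apply: qform_shift.
clearbody B'.
have [C C1 CP] := qform_le (invmx B').
(* The expansion gives [qform B' u >= 2 t - C t ^ 2] on the unit sphere; [t = 1 / C] maximizes the
   right side, with value [1 / C]. *)
have low u : qform 1%:M u = 1 -> C^-1 <= mu - qform A u.
  move=> u1; rewrite -[mu]mulr1 -u1 -B'q.
  pose v := u *m invmx B'.
  have : 0 <= qform B' (u - C^-1 *: v).
    by rewrite B'q subr_ge0.
  have -> : qform B' (u - C^-1 *: v) =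
     qform B' u - 2 * C^-1 * qform 1%:M u + C^-1 ^+ 2 * qform (invmx B') u.
    have vB : v *m B' = u by rewrite mulmxKV.
    have Bv : B' *m v^T = u^T.
      by rewrite -[in LHS]B'T -trmx_mul vB.
    have trB : (u - C^-1 *: v)^T = u^T - C^-1 *: v^T.
      by rewrite linearB /= linearZ.
    rewrite /qform trB mulmxBl -scalemxAl vB.
    rewrite mulmxBl !mulmxBr -!scalemxAl -!scalemxAr -[u *m B' *m v^T]mulmxA Bv.
    rewrite mulmx1 trmx_mul trmx_inv B'T mulmxA !mxE; ring.
  have := CP u; rewrite u1 mulr1 => h1 h2.
  have : C^-1 ^+ 2 * qform (invmx B') u <= C^-1 ^+ 2 * C.
    by rewrite ler_wpM2l // sqr_ge0.
  have -> : C^-1 ^+ 2 * C = C^-1 by field; rewrite gt_eqF.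
  move=> h3; lra.
have : mu <= mu - C^-1.
  apply: ge_sup => // _ [u /= u1 <-].
  by have := low _ u1; lra.
have Ci : 0 < C^-1 by rewrite invr_gt0.
lra.
Qed.

(** * Application to the adjacency matrix *)

Section Graph.
Variables (R : realType) (V : finType) (adj : rel V).
Local Notation w := (fun x y => (adj x y)%:R : R).
Local Notation A := (adjmx R adj).
Local Notation M := (calM R adj).

Lemma edge_pairsE (X Y : {set V}) :
  (edge_pairs adj X Y)%:R = \sum_(x in X) \sum_(y in Y) w x y.
Proof.
rewrite /edge_pairs -sum1_card natr_sum pair_big_dep /= big_mkcond.
rewrite [RHS]big_mkcond; apply: eq_bigr => -[x y] _ /=.
rewrite unfold_in /= andbA.
by case: (x \in X); case: (y \in Y); case: (adj x y).
Qed.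

Lemma calM_ge0 : 0 <= M.
Proof. exact: bigmax_ge_id. Qed.

Lemma edge_pairs_le_calM (X Y : {set V}) :
  (edge_pairs adj X Y)%:R <= M * (Num.sqrt #|X|%:R * Num.sqrt #|Y|%:R).
Proof.
have [->|X0] := eqVneq X finset.set0.
  by rewrite edge_pairsE big_set0 cards0 sqrtr0 mul0r mulr0.
have [->|Y0] := eqVneq Y finset.set0.
  rewrite edge_pairsE cards0 sqrtr0 !mulr0 big1 // => x _.
  by rewrite big_set0.
rewrite -sqrtrM // -ler_pdivrMr ?sqrtr_gt0; last first.
  by rewrite mulr_gt0 // ltr0n card_gt0.
by apply: (@le_bigmax_cond _ _ _ _ (X, Y)); rewrite /= X0.
Qed.

Lemma qform_adjmx (u : 'rV[R]_#|V|) :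
  qform A u = \sum_x \sum_y w x y * (u 0 (enum_rank x) * u 0 (enum_rank y)).
Proof.
rewrite qformE (reindex _ (onW_bij _ (enum_rank_bij V))).
apply: eq_bigr => x _; rewrite (reindex _ (onW_bij _ (enum_rank_bij V))).
by apply: eq_bigr => y _; rewrite mxE !enum_rankK.
Qed.

Lemma qform1_enum_rank (u : 'rV[R]_#|V|) :
  qform 1%:M u = \sum_x u 0 (enum_rank x) ^+ 2.
Proof. by rewrite qform1 (reindex _ (onW_bij _ (enum_rank_bij V))). Qed.

Hypothesis adj_sym : symmetric adj.

Lemma adjmx_sym : A^T = A.
Proof. by apply/matrixP => i j; rewrite !mxE adj_sym. Qed.

Lemma rayleigh_le_lambda_max (f : V -> R) :
  \sum_x \sum_y w x y * (f x * f y) <= lambda_max R adj * \sum_x f x ^+ 2.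
Proof.
have [V0|V0] := posnP #|V|.
  rewrite !big1 ?mulr0 // => x; by have := card0_eq V0 x.
have [mu muE muP] := rayleigh_sup_eigenvalue V0 adjmx_sym.
(* Since [mu] is an eigenvalue and bounds all the others, the set of eigenvalues has a genuine
   supremum. *)
have muM : mu <= lambda_max R adj.
  apply: sup_upper_bound => //; split; first by exists mu.
  exists mu => a /= /eigenvalueP[v vA v0].
  have N0 : 0 < qform 1%:M v by rewrite lt0r qform1_eq0 v0 qform1_ge0.
  have := muP v; rewrite {1}/qform vA -scalemxAl.
  by rewrite mxE -[v in v *m _]mulmx1 -/(qform 1%:M v) ler_pM2r.
pose u : 'rV[R]_#|V| := \row_i f (enum_val i).
have := muP u; rewrite qform_adjmx qform1_enum_rank.
have fE x : u 0 (enum_rank x) = f x by rewrite mxE enum_rankK.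
under eq_bigr do under eq_bigr do rewrite !fE.
under [X in _ <= _ * X]eq_bigr do rewrite fE.
move=> h; apply: le_trans h _; rewrite ler_wpM2r // sumr_ge0 // => x _.
exact: sqr_ge0.
Qed.

(** This handles the default [0] of the maximum in [calM]. The test function is the constant [1]. *)
Lemma lambda_max_ge0 : 0 <= lambda_max R adj.
Proof.
have [V0|V0] := posnP #|V|.
  rewrite /lambda_max (_ : [set a | _]%classic = set0) ?sup0 //.
  apply/seteqP; split => // a /= /eigenvalueP[v _ /eqP[]].
  by apply/rowP => i; have := ltn_ord i; rewrite {2}V0.
have := rayleigh_le_lambda_max (fun=> 1).
rewrite expr1n sumr_const mulr1 -[1 *+ _]/(#|V|%:R) => h.
rewrite -(pmulr_lge0 _ (_ : 0 < #|V|%:R)) ?ltr0n //.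
apply: le_trans h; apply: sumr_ge0 => x _; apply: sumr_ge0 => y _.
by rewrite mulr_ge0.
Qed.

(** Polarization: [4 B = Q (p + q) - Q (p - q)]. As the weights are nonnegative,
    [- Q (p - q) <= Q |p - q|], so upper Rayleigh bounds suffice. *)
Lemma bilinear_le_lambda_max (p q : V -> R) :
  \sum_x \sum_y w x y * (p x * q y)
    <= lambda_max R adj * (2^-1 * (\sum_x p x ^+ 2 + \sum_x q x ^+ 2)).
Proof.
set B := \sum_x \sum_y _.
have Bsym : B = \sum_x \sum_y w x y * (q x * p y).
  rewrite /B exchange_big; apply: eq_bigr => x _; apply: eq_bigr => y _ /=.
  by rewrite adj_sym (mulrC (p y)).
have h1 := rayleigh_le_lambda_max (fun x => p x + q x).
have h2 := rayleigh_le_lambda_max (fun x => `|p x - q x|).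
have : 2 * (B + \sum_x \sum_y w x y * (q x * p y)) <=
    \sum_x \sum_y w x y * ((p x + q x) * (p y + q y)) +
    \sum_x \sum_y w x y * (`|p x - q x| * `|p y - q y|).
  rewrite /B -!big_split mulr_sumr ler_sum // => x _ /=.
  rewrite -!big_split mulr_sumr ler_sum // => y _ /=.
  rewrite -!mulrDr mulrCA ler_wpM2l // -normrM.
  by have := ler_norm (- ((p x - q x) * (p y - q y))); rewrite normrN; lra.
have : \sum_x (p x + q x) ^+ 2 + \sum_x `|p x - q x| ^+ 2 =
    2 * (\sum_x p x ^+ 2 + \sum_x q x ^+ 2).
  rewrite -!big_split mulr_sumr; apply: eq_bigr => x _ /=.
  by rewrite real_normK ?num_real //; ring.
rewrite -Bsym => E h3.
have := lerD h1 h2; rewrite -mulrDr E => h4.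
lra.
Qed.

Lemma calM_le_lambda_max : M <= lambda_max R adj.
Proof.
apply: bigmax_le => [|[X Y] /= /andP[X0 Y0]]; first exact: lambda_max_ge0.
pose chi (Z : {set V}) x : R := (x \in Z)%:R / Num.sqrt #|Z|%:R.
have chi1 Z : Z != finset.set0 -> \sum_x chi Z x ^+ 2 = 1.
  move=> Z0; have cZ : #|Z|%:R != 0 :> R by rewrite pnatr_eq0 -lt0n card_gt0.
  transitivity (\sum_(x in Z) #|Z|%:R^-1 : R).
    rewrite [RHS]big_mkcond; apply: eq_bigr => x _; rewrite /chi.
    rewrite expr_div_n sqr_sqrtr //.
    by case: ifP => _; rewrite ?expr1n ?expr0n /= (mul1r, mul0r).
  by rewrite sumr_const -[_ *+ _]mulr_natr mulVf.
have := bilinear_le_lambda_max (chi X) (chi Y).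
rewrite !chi1 // (_ : 2^-1 * (1 + 1) = 1 :> R) ?mulr1; last by lra.
apply: le_trans.
rewrite edge_pairsE sqrtrM // big_mkcond /= mulr_suml ler_sum // => x _.
rewrite /chi; case: (x \in X); last first.
  by rewrite mul0r sumr_ge0 // => y _; rewrite !mul0r mulr0.
rewrite big_mkcond mulr_suml ler_sum // => y _ /=.
by rewrite invfM; case: (y \in Y); rewrite ?mul0r ?mulr0 // !mul1r.
Qed.

Lemma degree_le_max (x : V) : \sum_y w x y <= (max_degree adj)%:R.
Proof.
have -> : \sum_y w x y = (degree adj x)%:R.
  rewrite /degree -sum1_card natr_sum [RHS]big_mkcond; apply: eq_bigr => y _ /=.
  by rewrite unfold_in /=; case: (adj x y).
by rewrite ler_nat; apply: leq_bigmax.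
Qed.

(** The two ends of a single edge, as singletons, give quotient [1]. This absorbs the degree term
    [D / c = 1] into [M]. *)
Lemma calM_ge1 : (0 < max_degree adj)%N -> 1 <= M.
Proof.
rewrite lt0n; apply: contraR; rewrite -ltNge => M1.
rewrite -leqn0; apply/bigmax_leqP => x _; rewrite leqn0.
apply/eqP/eq_card0 => y; rewrite !inE; apply: contraTF M1 => xy.
rewrite -leNgt; have := edge_pairs_le_calM [set x] [set y].
by rewrite edge_pairsE !big_set1 !cards1 xy sqrtr1 !mulr1.
Qed.

Lemma eigenvalue_le_calM (a : R) :
  eigenvalue A a ->
  a <= Num.sqrt ((ln (max_degree adj)%:R + 1) * (4^-1 * ln #|V|%:R + 1)) * M.
Proof.
move=> /eigenvalueP[v vA v0].
have ln_nat_ge0 n : 0 <= ln (n%:R : R).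
  by case: n => [|n]; [rewrite ln0 | rewrite ln_ge0 // ler1n].
have N0 : 0 < qform 1%:M v by rewrite lt0r qform1_eq0 v0 qform1_ge0.
(* Passing to absolute values keeps the norm and does not decrease the form, so the estimates for
   nonnegative functions apply. *)
pose f x := `|v 0 (enum_rank x)|.
have f0 x : 0 <= f x by exact: normr_ge0.
have normE : \sum_x f x ^+ 2 = qform 1%:M v.
  rewrite qform1_enum_rank; apply: eq_bigr => x _.
  by rewrite real_normK ?num_real.
have av : a * qform 1%:M v <= \sum_x \sum_y w x y * (f x * f y).
  rewrite {1}(_ : _ * _ = qform A v); last first.
    by rewrite /qform vA -scalemxAl mulmx1 [RHS]mxE.
  rewrite qform_adjmx ler_sum // => x _; rewrite ler_sum // => y _.
  by rewrite ler_wpM2l // /f -normrM ler_norm.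
have rect (X Y : {set V}) : \sum_(x in X) \sum_(y in Y) w x y
    <= M * (Num.sqrt #|X|%:R * Num.sqrt #|Y|%:R).
  by rewrite -edge_pairsE edge_pairs_le_calM.
have colD y : \sum_x w x y <= (max_degree adj)%:R.
  by under eq_bigr do rewrite adj_sym; exact: degree_le_max.
have a1 : a <= (4^-1 * ln #|V|%:R + 1) * M.
  rewrite -(ler_pM2r N0); apply: le_trans av _; rewrite -normE.
  exact: sum_le_ln_card calM_ge0 f0 rect.
have a2 : a <= (ln (max_degree adj)%:R + 1) * M.
  (* The cut-off [c] will be the maximum degree, which must be at least [1]; without edges the form
     is [0]. *)
  rewrite -(ler_pM2r N0); have [D0|D0] := posnP (max_degree adj).
    apply: (@le_trans _ _ 0); last first.
      by rewrite mulr_ge0 ?(ltW N0) // mulr_ge0 ?calM_ge0 // addr_ge0.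
    apply: le_trans av _; apply: sumr_le0 => x _; apply: sumr_le0 => y _.
    suff -> : adj x y = false by rewrite mul0r.
    have : (degree adj x <= 0)%N by rewrite -D0 leq_bigmax.
    by rewrite leqn0 => /eqP/card0_eq/(_ y).
  apply: le_trans av _; rewrite -normE.
  have D1 : 1 <= (max_degree adj)%:R :> R by rewrite ler1n.
  have w0 x y : 0 <= w x y by [].
  apply: le_trans (sum_le_ln_degree calM_ge0 f0 w0 rect degree_le_max colD D1) _.
  rewrite ler_wpM2r ?normE ?(ltW N0) //.
  rewrite divff ?pnatr_eq0 -?lt0n // mulrDl mul1r mulrC lerD2l.
  exact: calM_ge1.
(* For [a > 0] the bounds [a1] and [a2] multiply to one on [a ^ 2], whose root is the claim. *)
have [a_le0|a_gt0] := leP a 0.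
  by apply: le_trans a_le0 _; rewrite mulr_ge0 ?calM_ge0 ?sqrtr_ge0.
have L0 : 0 <= (ln (max_degree adj)%:R + 1) * (4^-1 * ln #|V|%:R + 1) :> R.
  by rewrite mulr_ge0 ?addr_ge0 ?mulr_ge0 ?invr_ge0.
rewrite -ler_sqr ?nnegrE ?mulr_ge0 ?calM_ge0 ?sqrtr_ge0 ?(ltW a_gt0) //.
rewrite exprMn sqr_sqrtr // !expr2 mulrACA.
by rewrite ler_pM // ltW.
Qed.

End Graph.

Theorem theorem2 (R : realType) (V : finType) (adj : rel V)
  (adj_sym : symmetric adj) (adj_irr : irreflexive adj) :
  calM R adj <= lambda_max R adj /\
  lambda_max R adj <=
    Num.sqrt ((ln (max_degree adj)%:R + 1) * (4^-1 * ln #|V|%:R + 1))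
    * calM R adj.
Proof.
split; first exact: calM_le_lambda_max.
(* Without eigenvalues [lambda_max] is the default [0]. *)
have [E0|/set0P E0] := eqVneq [set a : R | eigenvalue (adjmx R adj) a]%classic set0.
  by rewrite /lambda_max E0 sup0 mulr_ge0 ?sqrtr_ge0 ?calM_ge0.
by apply: ge_sup => // a; apply: eigenvalue_le_calM.
Qed.
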